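(* Let $G$ be a $2$-connected graph of order $n$ with minimum degree $\delta$ and clique number $\omega$. If $\delta+\omega\ge n$, then $G$ is pancyclic, unless $G\cong K_{2,2}$, or $\frac{n+1}{2}\le \omega\le n-2$ and $G\cong K_{n-\omega}\vee (K_{2\omega-n}\cup \overline{K_{n-\omega}})$.
   Context: All graphs are finite, undirected, without loops or multiple edges. The clique number of $G$ is the maximum cardinality of a clique in $G$. A graph of order $n$ is pancyclic if it contains a cycle of length $k$ for every integer $k$ with $3\le k\le n$. $K_m$ denotes the complete graph on $m$ vertices, $\overline{K_m}$ the edgeless graph on $m$ vertices, and $K_{a,b}$ the complete bipartite graph with parts of sizes $a$ and $b$. For graphs $G,H$, $G\cup H$ is their disjoint union and $G\vee H$ (the join) is obtained from $G\cup H$ by adding all edges between $V(G)$ and $V(H)$. *)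

(* Defs.v *)
From mathcomp Require Import all_boot.

Set Implicit Arguments.
Unset Strict Implicit.
Unset Printing Implicit Defensive.

Record sgraph := SGraph {
  vertex :> finType;
  adj : rel vertex;
  adj_sym : symmetric adj;
  adj_irr : irreflexive adj }.

Arguments adj {G} x y : rename.

Definition isomorphic (G H : sgraph) : Prop :=
  exists2 f : G -> H, bijective f & {mono f : x y / adj x y}.

Section Invariants.
Variable G : sgraph.

Definition degree (x : G) : nat := #|[set y | adj x y]|.

(* Every degree is smaller than #|G|, so the default value of the iterated
   minimum is harmless as soon as G has a vertex. *)
Definition min_degree : nat := \big[minn/#|G|]_(x : G) degree x.

Definition is_clique (A : {set G}) : bool :=
  [forall x in A, forall y in A, (x != y) ==> adj x y].

Definition clique_number : nat := \max_(A : {set G} | is_clique A) #|A|.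

Definition connected_in (A : {set G}) : Prop :=
  {in A &, forall x y,
     connect [rel u v | [&& u \in A, v \in A & adj u v]] x y}.

Definition k_connected (k : nat) : Prop :=
  k < #|G| /\ forall S : {set G}, #|S| < k -> connected_in (~: S).

(* For k < 3 this would also accept closed walks that are not graph cycles
   (the empty one, and an edge traversed twice). *)
Definition has_cycle (k : nat) : Prop :=
  exists2 c : seq G, size c = k & ucycle adj c.

Definition pancyclic : Prop :=
  forall k, 3 <= k <= #|G| -> has_cycle k.

End Invariants.

Section Constructions.

Definition complete_adj m : rel 'I_m := fun x y => x != y.

Lemma complete_adj_sym m : symmetric (@complete_adj m).
Proof. by move=> x y; rewrite /complete_adj eq_sym. Qed.

Lemma complete_adj_irr m : irreflexive (@complete_adj m).
Proof. by move=> x; rewrite /complete_adj eqxx. Qed.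

Definition complete m : sgraph :=
  SGraph (@complete_adj_sym m) (@complete_adj_irr m).

Definition edgeless_adj m : rel 'I_m := fun _ _ => false.

Lemma edgeless_adj_sym m : symmetric (@edgeless_adj m).
Proof. by []. Qed.

Lemma edgeless_adj_irr m : irreflexive (@edgeless_adj m).
Proof. by []. Qed.

Definition edgeless m : sgraph :=
  SGraph (@edgeless_adj_sym m) (@edgeless_adj_irr m).

Definition bipartite_adj a b : rel ('I_a + 'I_b)%type := fun x y =>
  match x, y with
  | inl _, inr _ | inr _, inl _ => true
  | _, _ => false
  end.

Lemma bipartite_adj_sym a b : symmetric (@bipartite_adj a b).
Proof. by case=> x [] y. Qed.

Lemma bipartite_adj_irr a b : irreflexive (@bipartite_adj a b).
Proof. by case. Qed.

Definition complete_bipartite a b : sgraph :=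
  SGraph (@bipartite_adj_sym a b) (@bipartite_adj_irr a b).

(* cross tells whether the two summands are joined to each other: false gives
   the disjoint union and true gives the join. *)
Definition sum_adj (cross : bool) (G H : sgraph) : rel (G + H)%type :=
  fun x y =>
    match x, y with
    | inl u, inl v => adj u v
    | inr u, inr v => adj u v
    | _, _ => cross
    end.

Lemma sum_adj_sym cross G H : symmetric (@sum_adj cross G H).
Proof. by case=> x [] y //=; apply: adj_sym. Qed.

Lemma sum_adj_irr cross G H : irreflexive (@sum_adj cross G H).
Proof. by case=> x /=; apply: adj_irr. Qed.

Definition disjoint_union (G H : sgraph) : sgraph :=
  SGraph (@sum_adj_sym false G H) (@sum_adj_irr false G H).

Definition join (G H : sgraph) : sgraph :=
  SGraph (@sum_adj_sym true G H) (@sum_adj_irr true G H).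

End Constructions.

(* Main.v *)
Require Import Defs.
From mathcomp Require Import all_boot zify.

(** Let K be a maximum clique and S its complement, so that |S| <= delta.
    If S' is a subset of S, every vertex of S' still has at least |S'|
    neighbours in K :|: S'. Let M be the set of vertices of K with a neighbour
    in S', and suppose |M| >= 2. Ore's closure, applied after shrinking K to M
    plus at most one other vertex, shows that K :|: S' has a spanning cycle
    unless |M| = |S'|, M is a proper subset of K and every vertex of S' has
    neighbourhood M in K :|: S'. When S' = S this exception is the extremal
    graph; when 1 < |S'| < |S|, exchanging one vertex of S' for a vertex of
    S :\: S' destroys it, which gives cycles of all lengths above |K| + 1.
    Cliques of order at most 2 leave only the four-cycle. *)

Set Implicit Arguments.
Unset Strict Implicit.
Unset Printing Implicit Defensive.

(** * Ore's closure for spanning cycles of a vertex subset *)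

Section SpanningCycles.
Variable T : finType.
Implicit Types (e : rel T) (A K S : {set T}) (x y : T) (c p : seq T).

Definition nbrs e A x := [set y in A | e x y].

Definition clique_in e A := {in A &, forall x y, x != y -> e x y}.

(** Degenerate cycles are allowed: for a symmetric [e], an edge is a spanning cycle of its two
    ends. *)
Definition spanning_cycle e A := exists2 c, c =i A & ucycle e c.

Definition add_edge e x y : rel T :=
  [rel u v | [|| e u v, (u == x) && (v == y) | (u == y) && (v == x)]].

Lemma nbrsS e e' A x : subrel e e' -> nbrs e A x \subset nbrs e' A x.
Proof.
by move=> see'; apply/subsetP=> y; rewrite !inE => /andP[-> /see' ->].
Qed.

Lemma clique_path e A x p :
  clique_in e A -> {subset x :: p <= A} -> uniq (x :: p) -> path e x p.
Proof.
move=> Ae; elim: p x => //= y p IHp x sA /and3P[]; rewrite inE negb_or.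
case/andP=> xy _ yp up.
have -> /= : e x y by apply: Ae => //; apply: sA; rewrite !inE eqxx ?orbT.
by apply: IHp; rewrite /= ?yp // => z z_yp; apply: sA; rewrite inE z_yp orbT.
Qed.

Lemma clique_spanning_cycle e A :
  clique_in e A -> 1 < #|A| -> spanning_cycle e A.
Proof.
move=> Ae A_gt1; exists (enum A) => [x|]; first by rewrite mem_enum.
rewrite /ucycle enum_uniq andbT.
have := enum_uniq A; have : {subset enum A <= A} by move=> x; rewrite mem_enum.
move: A_gt1; rewrite cardE; case: (enum A) => [|x [|y p]] // _ sA up.
rewrite (cycle_path x) [last _ _]/=.
have xNy : last y p != x.
  by apply: contraTneq up => <-; rewrite cons_uniq mem_last.
apply/andP; split; last exact: clique_path Ae sA up.
apply: Ae xNy; last exact: sA (mem_head _ _).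
by apply: sA; rewrite inE mem_last orbT.
Qed.

(* By counting, some w adjacent to the last vertex is followed on the path by a
   neighbour of x; reversing the path after w closes it into a cycle. *)
Lemma crossing_spanning_cycle e A x p :
    symmetric e -> irreflexive e -> x :: p =i A -> uniq (x :: p) -> path e x p ->
    #|A| <= #|nbrs e A x| + #|nbrs e A (last x p)| ->
  spanning_cycle e A.
Proof.
move=> e_sym e_irr cA uc ep degs; set y := last x p in degs.
(* Successor along the path, wrapping from [y] back to [x]; it is injective on the whole type. *)
pose f := next (x :: p).
have f_inj : injective f by apply: can_inj (prev_next uc).
have fy : f y = x.
  by rewrite /f next_nth mem_last /y index_last // nth_default.
have fA w : (f w \in A) = (w \in A) by rewrite -!cA mem_next.
have [w] : exists w, w \in nbrs e A y /\ e x (f w).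
  have [/existsP[w /andP[]]|none] := boolP [exists w in nbrs e A y, e x (f w)].
    by exists w.
  (* Without such a [w], the neighbours of [x] and the successors of neighbours of [y] form disjoint
     sets avoiding [x], so the degree sum is below |A|. *)
  suff: #|nbrs e A x :|: f @: nbrs e A y| <= #|A :\ x|.
    rewrite cardsU disjoint_setI0 ?cards0 ?subn0 ?card_imset //.
      by rewrite leqNgt (leq_trans _ degs) // (cardsD1 x A) -cA mem_head.
    rewrite disjoint_sym; apply/pred0P=> z; apply/negP=> /= /andP[/imsetP[w]].
    move=> wy -> ; rewrite inE => /andP[_ exw]; case/negP: none.
    by apply/existsP; exists w; rewrite wy.
  apply/subset_leq_card/subsetP=> z; rewrite !inE => /orP[/andP[-> exz]|].
    by rewrite andbT; apply: contraTneq exz => ->; rewrite e_irr.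
  case/imsetP=> w; rewrite inE => /andP[wA eyw] ->; rewrite fA wA andbT.
  by apply: contraTneq eyw; rewrite -fy => /f_inj->; rewrite e_irr.
case; rewrite inE -cA => /andP[wc eyw] exfw.
have [p1 [p2 [Ep wE]]] : exists p1 p2, p = p1 ++ p2 /\ w = last x p1.
  by case/splitPl: wc => p1 p2 wE; exists p1, p2.
case: p2 Ep => [|z p2] Ep.
  by move: eyw; rewrite /y Ep cats0 -wE e_irr.
have fw : f w = z.
  rewrite /f next_nth wc Ep -cat_cons index_cat {1 2}wE mem_last.
  move: uc; rewrite Ep -cat_cons cat_uniq => /and3P[u1 _ _].
  by rewrite index_last // nth_cat ltnn subnn.
move: ep; rewrite Ep cat_path -wE /= => /and3P[ep1 _ ep2].
exists (x :: p1 ++ rev (z :: p2)).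
  by move=> u; rewrite -cA Ep !inE !mem_cat mem_rev.
apply/andP; split; last first.
  by move: uc; rewrite Ep -!cat_cons !cat_uniq rev_uniq has_rev.
rewrite fw in exfw.
rewrite /= rcons_path last_cat rev_cons last_rcons (e_sym z) exfw andbT.
have yE : y = last z p2 by rewrite /y Ep last_cat.
rewrite -rev_cons cat_path ep1 -wE lastI rev_rcons /= -yE e_sym eyw /=.
by rewrite yE rev_path; apply: sub_path ep2 => u v; rewrite e_sym.
Qed.

(** The Bondy-Chvatal step: deleting the new edge from a spanning cycle that uses it leaves a
    spanning path between [x] and [y], to which the crossing argument applies. *)
Lemma add_edge_spanning_cycle e A x y :
    symmetric e -> irreflexive e -> x \in A -> y \in A -> x != y ->
    #|A| <= #|nbrs e A x| + #|nbrs e A y| ->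
  spanning_cycle (add_edge e x y) A -> spanning_cycle e A.
Proof.
move=> e_sym e_irr xA yA xy degs [c cA /andP[ec uc]].
have [all_e|] := boolP (all (fun u => e u (next c u)) c).
  by exists c; rewrite // /ucycle uc andbT; apply/cycle_from_next/allP.
case/allPn=> u u_c /= not_e; have := next_cycle ec u_c.
set v := next c u in not_e *; rewrite /add_edge /= (negPf not_e) /= => uv.
(* The cycle may traverse the new edge in either direction; from here on only the oriented pair [u],
   [v] matters. *)
have [degs' e1E] : #|A| <= #|nbrs e A v| + #|nbrs e A u| /\
    (forall w z, add_edge e x y w z ->
       [\/ e w z, w = u /\ z = v | w = v /\ z = u]).
  case/orP: uv => /andP[/eqP-> /eqP->]; split=> //; rewrite 1?addnC // => w z.
    by case/or3P => [?|/andP[/eqP-> /eqP->]|/andP[/eqP-> /eqP->]];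
      [apply: Or31|apply: Or32|apply: Or33].
  by case/or3P => [?|/andP[/eqP-> /eqP->]|/andP[/eqP-> /eqP->]];
    [apply: Or31|apply: Or33|apply: Or32].
have v_c : v \in c by rewrite mem_next.
have [i p cE] := rot_to v_c.
have uE : u = last v p.
  have uc' : uniq (v :: p) by rewrite -cE rot_uniq.
  apply: (can_inj (prev_next uc)); rewrite -/v -(next_rot i) // cE next_nth.
  by rewrite mem_last index_last // nth_default.
have cA' : v :: p =i A by move=> z; rewrite -cE mem_rot.
have uc' : uniq (v :: p) by rewrite -cE rot_uniq.
have ec' : path (add_edge e x y) v p.
  by move: ec; rewrite -(rot_cycle i) cE /= rcons_path => /andP[].
apply: (crossing_spanning_cycle e_sym e_irr cA' uc'); last by rewrite -uE.
case/lastP: p uE {cE} cA' uc' ec' => [|q z] //; rewrite last_rcons => <-.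
move=> cA' uc' /=; rewrite !rcons_path => /andP[eq elast].
have u_notin : u \notin v :: q.
  by move: uc'; rewrite -rcons_cons rcons_uniq => /andP[].
(* The path [v :: q] misses [u], so it cannot use the new edge. *)
have -> : path e v q.
  apply: (sub_in_path (P := predC1 u) _ _ eq); last first.
    by apply/allP=> z'; apply: contraTneq => ->.
  move=> a b /= /negPf au /negPf bu.
  by case/e1E=> [//|[/eqP]|[_ /eqP]]; rewrite ?au ?bu.
(* The final edge can be the new one only if [q] is empty; then A = {u, v} spans no edge, against
   the degree sum. *)
case: (e1E _ _ elast) => [//|[lu _]|[lv _]].
  by have := mem_last v q; rewrite lu (negPf u_notin).
case: q lv uc' cA' {eq elast u_notin} => [_|a q /= lv]; last first.
  have va := mem_last a q; rewrite lv in va.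
  by rewrite -rcons_cons mem_rcons inE va orbT.
move=> /= uc' cA'; move: degs'.
have nA w : w \in A -> w = v \/ w = u.
  by rewrite -cA' !inE => /orP[] /eqP; [left|right].
have euv : e u v = false by apply: negPf.
have evu : e v u = false by rewrite e_sym.
suff n0 w : w = v \/ w = u -> nbrs e A w = set0.
  rewrite !n0 ?cards0; [|by right|by left].
  by rewrite leqn0 cards_eq0 => /eqP A0; move: xA; rewrite A0 inE.
move=> wE; apply/setP=> z'; rewrite !inE; apply/negP=> /andP[/nA zE].
by case: wE zE => -> [] ->; rewrite ?e_irr ?euv ?evu.
Qed.

Definition ore_closed e A := {in A &, forall x y, x != y ->
  #|A| <= #|nbrs e A x| + #|nbrs e A y| -> e x y}.

(** Induction on the number of non-adjacent ordered pairs: join a pair that violates closedness and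
    pull spanning cycles back along the added edge. *)
Lemma ore_closure e A : symmetric e -> irreflexive e ->
  exists e', [/\ symmetric e', irreflexive e', subrel e e', ore_closed e' A
                & spanning_cycle e' A -> spanning_cycle e A].
Proof.
have [n] := ubnP #|[set p : T * T | ~~ e p.1 p.2]|.
elim: n e => // n IHn e; rewrite ltnS => ltn e_sym e_irr.
have [/existsP[[x y] /and5P[/= xA yA xy exy degs]]|none] :=
  boolP [exists p : T * T,
    [&& p.1 \in A, p.2 \in A, p.1 != p.2, ~~ e p.1 p.2
      & #|A| <= #|nbrs e A p.1| + #|nbrs e A p.2|]].
  have e1e : subrel e (add_edge e x y) by move=> u v euv; apply/or3P/Or31.
  have [|u v|u|e' [e'_sym e'_irr see' e'_ore e'A]] := IHn (add_edge e x y).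
  - apply: leq_trans ltn; apply: proper_card.
    apply/properP; split.
      by apply/subsetP=> p; rewrite !inE; apply: contra => /e1e.
    by exists (x, y); rewrite !inE //= /add_edge /= !eqxx orbT.
  - rewrite /add_edge /= e_sym; congr (_ || _).
    by rewrite orbC andbC [(u == x) && _]andbC.
  - rewrite /add_edge /= e_irr /=; apply/negP=> /orP[] /andP[/eqP uE1 /eqP uE2];
    by rewrite -uE1 -uE2 eqxx in xy.
  exists e'; split=> // [u v /e1e/see'//|/e'A].
  exact: add_edge_spanning_cycle.
exists e; split=> // x y xA yA xy degs; apply: contraNT none => exy.
by apply/existsP; exists (x, y); rewrite /= xA yA xy exy.
Qed.

(* The neighbour following v on the cycle lies in K, so the missing vertices of
   K can be inserted between the two. *)
Lemma absorb_clique_spanning_cycle e A K v :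
    clique_in e K -> v \in K -> v \in A -> 1 < #|A| -> nbrs e A v \subset K ->
  spanning_cycle e A -> spanning_cycle e (K :|: A).
Proof.
move=> Ke vK vA A_gt1 vnK [c cA /andP[ec uc]].
have [i p cE] : rot_to_spec c v by apply: rot_to; rewrite cA.
have {cE i c cA ec uc} [pA ep up] :
    [/\ v :: p =i A, path e v (rcons p v) & uniq (v :: p)].
  rewrite -[path _ _ _]/(cycle e (v :: p)) -cE rot_cycle rot_uniq.
  by split=> // x; rewrite mem_rot.
case: p => [|a p] in pA ep up.
  by rewrite -(eq_card pA) (card_uniqP up) in A_gt1.
case/andP: ep => eva ep; set q := enum (K :\: A).
have q_in x : x \in q -> (x \in K) && (x \notin A).
  by rewrite mem_enum !inE andbC.
have aA : a \in A by rewrite -pA !inE eqxx orbT.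
have aK : a \in K by apply: (subsetP vnK); rewrite inE aA.
have vNa : v != a by case/andP: up; rewrite inE negb_or => /andP[].
have uvq : uniq (v :: q).
  by rewrite /= enum_uniq andbT; apply/negP=> /q_in; rewrite vA andbF.
have vqK : {subset v :: q <= K}.
  by move=> x; rewrite inE => /orP[/eqP->//|/q_in/andP[]].
exists (v :: q ++ a :: p).
  move=> x; rewrite -cat_cons mem_cat !inE mem_enum !inE -pA !inE.
  by case: (x == v); case: (x == a); case: (x \in p); case: (x \in K).
apply/andP; split.
  rewrite -[cycle e _]/(path e v (rcons (q ++ a :: p) v)) rcons_cat cat_path.
  rewrite (clique_path Ke vqK uvq) andTb.
  apply/andP; split; last exact: ep.
  apply: Ke => //; first exact: vqK (mem_last _ _).
  have := mem_last v q; rewrite inE => /orP[/eqP->//|/q_in/andP[_]].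
  by apply: contraNneq => ->.
rewrite -cat_cons cat_uniq uvq andTb.
move: up; rewrite cons_uniq => /andP[va ->]; rewrite andbT.
apply/hasPn=> x xp; rewrite inE negb_or.
have xA : x \in A by rewrite -pA inE xp orbT.
apply/andP; split; first by apply: contraNneq va => <-.
by apply/negP=> /q_in; rewrite xA andbF.
Qed.

(** * Spanning cycles of a clique together with outside vertices *)

Definition boundary e K S := [set y in K | [exists x in S, e x y]].

Lemma boundaryP e K S y :
  reflect (y \in K /\ exists2 x, x \in S & e x y) (y \in boundary e K S).
Proof.
rewrite inE; apply: (iffP andP) => -[yK].
  by case/existsP=> x /andP[xS exy]; split=> //; exists x.
by case=> x xS exy; split=> //; apply/existsP; exists x; rewrite xS.
Qed.

(** The closure joins S completely to M. If M = K, or some vertex of S has closure degree above |S|,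
    the closure is complete on A. Otherwise closure degrees on S equal |S|, which forces |M| =
    |S|. *)
Lemma spanning_cycle_small_clique e K S :
    symmetric e -> irreflexive e -> clique_in e K -> [disjoint K & S] ->
    {in S, forall x, #|S| <= #|nbrs e (K :|: S) x|} ->
    1 < #|boundary e K S| -> #|K| <= #|boundary e K S|.+1 ->
  spanning_cycle e (K :|: S)
  \/ [/\ #|boundary e K S| = #|S|, boundary e K S \proper K
       & {in S, forall x, nbrs e (K :|: S) x = boundary e K S}].
Proof.
move=> e_sym e_irr Ke dKS degS; set M := boundary e K S; set A := K :|: S.
move=> M_gt1 leKM.
have cardA : #|A| = #|K| + #|S| by apply/eqP; rewrite (leq_card_setU K S).2.
have MK : M \subset K by apply/subsetP=> y /boundaryP[].
have leMK := subset_leq_card MK.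
have KNS y : y \in K -> y \in S = false := disjointFr dKS.
have [e' [e's e'i see' e'o e'A]] := ore_closure A e_sym e_irr.
have SA x : x \in S -> x \in A by rewrite inE orbC => ->.
have KA y : y \in K -> y \in A by rewrite inE => ->.
have neqSK x y : x \in S -> y \in K -> x != y.
  by move=> xS yK; apply: contraTneq xS => ->; rewrite KNS.
have e'oSK x y : x \in S -> y \in K ->
    #|K| + #|S| <= #|nbrs e' A x| + #|nbrs e' A y| -> e' x y.
  move=> xS yK; rewrite -cardA.
  exact: e'o (SA _ xS) (KA _ yK) (neqSK _ _ xS yK).
have degS' x : x \in S -> #|S| <= #|nbrs e' A x|.
  by move=> xS; apply: leq_trans (degS x xS) (subset_leq_card (nbrsS _ _ see')).
have degK y : y \in K -> #|K| <= #|nbrs e' A y|.+1.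
  move=> yK; rewrite (cardsD1 y) yK add1n ltnS; apply/subset_leq_card/subsetP=> z.
  by rewrite !inE => /andP[zy zK]; rewrite zK see' // Ke // eq_sym.
have degKS x y : y \in K -> x \in S -> e' x y -> #|K| <= #|nbrs e' A y|.
  move=> yK xS exy; have -> : #|K| = #|x |: (K :\ y)|.
    by rewrite cardsU1 (cardsD1 y K) yK !inE [x \in K](disjointFl dKS) ?andbF.
  apply/subset_leq_card/subsetP=> z; rewrite !inE => /orP[/eqP->|/andP[zy zK]].
    by rewrite xS orbT e's.
  by rewrite zK see' // Ke // eq_sym.
(* A neighbour in S lifts the degree of [y] from |K| - 1 to |K|, just enough for Ore's condition. *)
have e'SM x y : x \in S -> y \in M -> e' x y.
  move=> xS /boundaryP[yK [x' x'S ex'y]].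
  apply: e'oSK => //; rewrite addnC leq_add ?degS' //.
  exact: degKS x'S (see' _ _ ex'y).
have complete_case : {in S & K, forall x y, e' x y} -> spanning_cycle e A.
  move=> SK; apply: e'A.
  (* Closure degrees on S are now at least |K| and at least |S|, so two of them sum to at least
     |A|. *)
  have S_clique : clique_in e' S.
    move=> x z xS zS xz; apply: e'o; rewrite ?SA // cardA.
    have degSK w : w \in S -> #|K| <= #|nbrs e' A w|.
      move=> wS; apply/subset_leq_card/subsetP=> y yK.
      by rewrite !inE yK SK.
    have := (degSK _ xS, degSK _ zS, degS' _ xS, degS' _ zS); case=> [[[]]]; lia.
  apply: clique_spanning_cycle; last by rewrite cardA; lia.
  move=> x y; rewrite !inE => /orP[xK|xS] /orP[yK|yS] xy.
  - by apply: see'; apply: Ke.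
  - by rewrite e's SK.
  - by rewrite SK.
  - exact: S_clique.
have [KM|] := leqP #|K| #|M|.
  left; apply: complete_case => x y xS yK; apply: e'SM => //.
  by rewrite (_ : M = K) //; apply/eqP; rewrite eqEcard MK.
(* One vertex of S of degree above |S| makes up for the degree |K| - 1 in K. It becomes adjacent to
   all of K, whose degrees then reach |K|, so all of S is joined to K. *)
move=> ltMK; have [/existsP[x /andP[xS degx]]|small] :=
    boolP [exists x in S, #|S| < #|nbrs e' A x|].
  left; apply: complete_case => x' y x'S yK.
  have exy : e' x y.
    by apply: e'oSK => //; have := degK y yK; lia.
  apply: e'oSK => //; rewrite addnC leq_add ?degS' //.
  exact: degKS exy.
have degS_le x : x \in S -> #|nbrs e' A x| <= #|S|.
  move=> xS; rewrite leqNgt; apply: contra small => degx.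
  by apply/existsP; exists x; rewrite xS.
have M_nbrs x : x \in S -> M \subset nbrs e' A x.
  by move=> xS; apply/subsetP=> y yM; rewrite !inE (subsetP MK) // e'SM.
have [x0 x0S] : exists x, x \in S.
  have /card_gt0P[y /boundaryP[_ [x xS _]]] : 0 < #|M| by apply: ltnW.
  by exists x.
have MS : #|M| = #|S|.
  apply/eqP; rewrite eqn_leq.
  rewrite (leq_trans (subset_leq_card (M_nbrs _ x0S))) ?degS_le //=.
  (* Here |K| <= |M| + 1 <= |S| makes S a clique of the closure, and [x0] would have |S| - 1 + |M| >
     |S| neighbours. *)
  rewrite leqNgt; apply/negP=> ltMS.
  suff: #|(S :\ x0) :|: M| <= #|S|.
    rewrite cardsU disjoint_setI0 ?cards0 ?subn0.
      by have := cardsD1 x0 S; rewrite x0S; lia.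
    apply: disjointWl (subsetDl _ _) _; rewrite disjoint_sym.
    exact: disjointWl MK dKS.
  apply: leq_trans (degS_le _ x0S); apply/subset_leq_card.
  rewrite subUset M_nbrs //.
  rewrite andbT; apply/subsetP=> z; rewrite !inE => /andP[zx zS].
  rewrite zS orbT e'o ?SA // 1?eq_sym // cardA.
  have := (degS' _ x0S, degS' _ zS); case; lia.
right; split=> //; first by rewrite properEcard MK.
(* Degrees already equal to |S| in [e] leave no room for closure edges at [x]. *)
move=> x xS; have nE : nbrs e A x = nbrs e' A x.
  apply/eqP; rewrite eqEcard nbrsS //=.
  by apply: leq_trans (degS_le _ xS) (degS x xS).
by apply/esym/eqP; rewrite nE eqEcard M_nbrs // MS degS_le.
Qed.

(** Shrinking K to M and one further vertex [v] changes no neighbourhood of S. As [v] has no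
    neighbour in S, the rest of K can be reinserted next to it. *)
Lemma spanning_cycle_clique e K S :
    symmetric e -> irreflexive e -> clique_in e K -> [disjoint K & S] ->
    {in S, forall x, #|S| <= #|nbrs e (K :|: S) x|} ->
    1 < #|boundary e K S| ->
  spanning_cycle e (K :|: S)
  \/ [/\ #|boundary e K S| = #|S|, boundary e K S \proper K
       & {in S, forall x, nbrs e (K :|: S) x = boundary e K S}].
Proof.
move=> e_sym e_irr Ke dKS degS M_gt1.
have [leKM|ltMK] := leqP #|K| #|boundary e K S|.
  by apply: spanning_cycle_small_clique => //; apply: leqW.
set M := boundary e K S in M_gt1 ltMK *.
have MK : M \subset K by apply/subsetP=> y /boundaryP[].
have MpK : M \proper K by rewrite properEcard MK.
have /properP[_ [v vK vM]] := MpK.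
have K1K : v |: M \subset K by rewrite subUset sub1set vK.
have bd1 : boundary e (v |: M) S = M.
  apply/setP=> y; apply/boundaryP/boundaryP=> -[yK yS]; split=> //.
    exact: (subsetP K1K).
  by rewrite in_setU1; apply/orP; right; apply/boundaryP.
have nE : {in S, forall x, nbrs e (v |: M :|: S) x = nbrs e (K :|: S) x}.
  move=> x xS; apply/setP=> y; rewrite [LHS]in_set [RHS]in_set.
  rewrite (in_setU y (v |: M)) (in_setU y K).
  have [exy|] := boolP (e x y); rewrite ?andbF // !andbT; congr (_ || _).
  apply/idP/idP; first exact: (subsetP K1K).
  move=> yK; rewrite in_setU1; apply/orP; right.
  by apply/boundaryP; split=> //; exists x.
have [|||||cyc|[MS _ nM]] :=
  @spanning_cycle_small_clique e (v |: M) S e_sym e_irr.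
- by move=> x y /(subsetP K1K) xK /(subsetP K1K); apply: Ke.
- exact: disjointWl dKS.
- by move=> x xS; rewrite nE // degS.
- by rewrite bd1.
- by rewrite bd1 cardsU1 vM.
- left; have -> : K :|: S = K :|: (v |: M :|: S).
    by rewrite setUA (setUidPl K1K).
  apply: (absorb_clique_spanning_cycle Ke vK) cyc.
  + by rewrite !inE eqxx.
  + apply: leq_trans M_gt1 _; apply/subset_leq_card.
    by rewrite -setUA setUCA subsetUl.
  apply/subsetP=> y; rewrite 2!inE => /andP[/orP[/(subsetP K1K)//|yS] evy].
  by case/negP: vM; apply/boundaryP; split=> //; exists y; rewrite // e_sym.
by right; rewrite -bd1 MS; split=> //; [rewrite bd1 | move=> x xS; rewrite -nE ?nM].
Qed.

End SpanningCycles.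

(** * Cliques, degrees and boundaries in a graph *)

Lemma subset_between (T : finType) (B S : {set T}) j :
    B \subset S -> #|B| <= j <= #|S| ->
  exists S' : {set T}, [/\ B \subset S', S' \subset S & #|S'| = j].
Proof.
move=> BS /andP[leBj]; elim: j leBj => [|j IHj] leBj lejS.
  by exists B; split=> //; apply/eqP; rewrite -leqn0.
have [eBj|ltBj] := eqVneq #|B| j.+1; first by exists B.
have [||S' [BS' S'S cS']] := IHj; [lia|lia|].
have /properP[_ [x xS xS']] : S' \proper S by rewrite properEcard S'S cS'.
exists (x |: S'); rewrite cardsU1 xS' cS'; split=> //.
  exact: subset_trans BS' (subsetUr _ _).
by rewrite subUset sub1set xS.
Qed.

Section Graphs.
Variable G : sgraph.
Implicit Types (x y z : G) (K S A : {set G}).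

Local Notation edge := (@adj G).

Lemma spanning_has_cycle A : spanning_cycle edge A -> has_cycle G #|A|.
Proof.
case=> c cA /andP[ec uc]; exists c; last by rewrite /ucycle ec.
by rewrite -(eq_card cA) (card_uniqP uc).
Qed.

Lemma min_degree_le x : min_degree G <= degree x.
Proof.
rewrite /min_degree; have := mem_index_enum x.
elim: (index_enum G) => //= y r IHr; rewrite inE big_cons geq_min.
by case/orP=> [/eqP->|/IHr->]; rewrite ?leqnn ?orbT.
Qed.

Lemma max_clique_exists :
  exists2 K, clique_in edge K & #|K| = clique_number G.
Proof.
have clique_gt0 : 0 < #|@is_clique G|.
  by apply/card_gt0P; exists set0; apply/forall_inP=> x; rewrite inE.
have [K cK KE] := eq_bigmax_cond (fun A : {set G} => #|A|) clique_gt0.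
exists K => // x y xK yK xy.
by move/forall_inP/(_ x xK)/forall_inP/(_ y yK)/implyP/(_ xy): cK.
Qed.

Lemma clique_card_le A : clique_in edge A -> #|A| <= clique_number G.
Proof.
move=> Ae; apply: (@leq_bigmax_cond _ _ (fun A : {set G} => #|A|)).
apply/forall_inP=> x xA; apply/forall_inP=> y yA; apply/implyP; exact: Ae.
Qed.

(** Otherwise a single vertex [y] of K covers the boundary, and deleting it separates the rest of K
    from the complement. *)
Lemma two_connected_boundary K :
    k_connected G 2 -> 1 < #|K| -> 0 < #|~: K| ->
  1 < #|boundary edge K (~: K)|.
Proof.
move=> [_ conn] K_gt1 /card_gt0P[x xK]; rewrite ltnNge; apply/negP=> le1.
set M := boundary edge K (~: K) in le1.
have [y My yK] : exists2 y, M \subset [set y] & y \in K.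
  have [M0|/set0Pn[y yM]] := eqVneq M set0.
    have /card_gt0P[y yK] := ltnW K_gt1.
    by exists y => //; rewrite M0 sub0set.
  exists y; last by case/boundaryP: yM.
  rewrite (_ : M = [set y]) //; apply/esym/eqP.
  by rewrite eqEcard sub1set yM cards1.
have /card_gt0P[z] : 0 < #|K :\ y| by have := cardsD1 y K; rewrite yK; lia.
rewrite !inE => /andP[zy zK].
have xy : x != y by apply: contraTneq xK => ->; rewrite inE yK.
have := conn [set y]; rewrite cards1 => /(_ isT x z).
rewrite !inE => /(_ xy zy) xz.
suff clK : closed
    [rel u v | [&& u \in ~: [set y], v \in ~: [set y] & adj u v]] (mem K).
  rewrite in_setC in xK.
  by have /= := closed_connect clK xz; rewrite (negPf xK) zK.
have step u v : u != y -> adj u v -> u \in K -> v \in K.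
  move=> uy uv uK; apply: contraNT uy => vK; rewrite -in_set1.
  apply: (subsetP My); apply/boundaryP; split=> //; exists v; first by rewrite inE.
  by rewrite adj_sym.
move=> u v /= /and3P[]; rewrite !inE => uy vy uv.
by apply/idP/idP; apply: step; rewrite // adj_sym.
Qed.

(** * Cycles of every length around a clique *)

Section Pancyclic.
Variable K : {set G}.
Hypothesis Ke : clique_in edge K.
Local Notation S := (~: K).
Hypothesis degS : {in S, forall x, #|S| <= degree x}.

(** At most |S| - |S'| neighbours are lost outside K :|: S'. *)
Lemma degree_in_subset S' : S' \subset S ->
  {in S, forall x, #|S'| <= #|nbrs edge (K :|: S') x|}.
Proof.
move=> S'S x xS.
have sub : [set y | adj x y] \subset nbrs edge (K :|: S') x :|: (S :\: S').
  apply/subsetP=> y; rewrite !inE => ->.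
  by case: (y \in K); case: (y \in S').
have := leq_trans (degS xS) (subset_leq_card sub).
have := (leq_card_setU (nbrs edge (K :|: S') x) (S :\: S')).1.
have := subset_leq_card S'S; rewrite cardsD (setIidPr S'S); lia.
Qed.

Lemma clique_disjoint S' : S' \subset S -> [disjoint K & S'].
Proof. by move=> S'S; rewrite disjoint_sym disjoints_subset. Qed.

Lemma card_clique_setU S' : S' \subset S -> #|K :|: S'| = #|K| + #|S'|.
Proof.
by move/clique_disjoint=> dKS'; apply/eqP; rewrite (leq_card_setU _ _).2.
Qed.

Lemma spanning_cycle_subset S' : S' \subset S ->
    1 < #|boundary edge K S'| ->
  spanning_cycle edge (K :|: S')
  \/ [/\ #|boundary edge K S'| = #|S'|, boundary edge K S' \proper K
       & {in S', forall x, nbrs edge (K :|: S') x = boundary edge K S'}].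
Proof.
move=> S'S; apply: spanning_cycle_clique (clique_disjoint S'S) _ => //.
- exact: adj_sym.
- exact: adj_irr.
by move=> x xS'; apply: degree_in_subset (subsetP S'S _ xS').
Qed.

(** A vertex of S with two neighbours in K is added to K. If there is none, S is a clique, and
    adjacent [x1], [x2] with distinct neighbours in K replace a third vertex [z] of K. *)
Lemma has_cycle_one_more :
  2 < #|K| -> 1 < #|boundary edge K S| -> has_cycle G #|K|.+1.
Proof.
move=> K_gt2 /card_gt1P[y1 [y2 [/boundaryP[y1K [x1 x1S e11]]]]].
move=> /boundaryP[y2K [x2 x2S e22]] y12.
have [/existsP[x /andP[xS M_gt1]]|none] :=
    boolP [exists x in S, 1 < #|boundary edge K [set x]|].
  have xS' : [set x] \subset S by rewrite sub1set.
  have [/spanning_has_cycle|[cM _ _]] := spanning_cycle_subset xS' M_gt1.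
    by rewrite card_clique_setU // cards1 addn1.
  by rewrite cM cards1 in M_gt1.
have le1 x : x \in S -> #|boundary edge K [set x]| <= 1.
  move=> xS; rewrite leqNgt; apply: contra none => M_gt1.
  by apply/existsP; exists x; rewrite xS.
have x12 : x1 != x2.
  apply: contraTneq (le1 _ x1S) => x12; rewrite -ltnNge.
  apply/card_gt1P; exists y1, y2; split=> //; apply/boundaryP; split=> //.
    by exists x1; rewrite ?set11.
  by exists x1; rewrite ?set11 // x12.
(* Each vertex of S has at most one neighbour in K, hence is adjacent to all of
   S. *)
have S_clique : clique_in edge S.
  move=> x z xS zS xz; apply: contraLR (degS xS) => nxz; rewrite -ltnNge.
  have sub : [set y | adj x y] \subset boundary edge K [set x] :|: (S :\ x) :\ z.
    apply/subsetP=> y; rewrite inE => exy; rewrite in_setU !in_setD1 in_setC.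
    have -> : y != z by apply: contraNneq nxz => <-.
    have -> : y != x by apply: contraTneq exy => ->; rewrite adj_irr.
    rewrite orbC -implybE; apply/implyP=> yK; apply/boundaryP; split=> //.
    by exists x; rewrite ?set11.
  have := cardsD1 x S; have := cardsD1 z (S :\ x).
  rewrite in_setD1 eq_sym xz xS zS => -> ->; rewrite !add1n ltnS.
  apply: leq_trans (subset_leq_card sub) _.
  apply: leq_trans (leq_card_setU _ _).1 _.
  by rewrite -add1n leq_add2r le1.
have [z zK zy] : exists2 z, z \in K & z \notin [set y1; y2].
  have /properP[_ [z zK zy]] : [set y1; y2] \proper K.
    by rewrite properEcard subUset !sub1set y1K y2K cards2 y12.
  by exists z.
have zKS x : x \in S -> x \notin K by rewrite inE.
have inK' y : y \in [set y1; y2] -> y \in K -> y \in K :\ z.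
  by move=> yy yK; rewrite in_setD1 yK andbT; apply: contraNneq zy => <-.
have y1K' : y1 \in K :\ z by rewrite inK' // !inE eqxx.
have y2K' : y2 \in K :\ z by rewrite inK' // !inE eqxx orbT.
have dKS : [disjoint K :\ z & [set x1; x2]].
  apply: disjointWl (subsetDl _ _) _; apply: clique_disjoint.
  by rewrite subUset !sub1set x1S.
have e12 : edge x1 x2 by apply: S_clique.
have in_nbrs x y :
    y \in K :\ z :|: [set x1; x2] -> edge x y ->
    y \in nbrs edge (K :\ z :|: [set x1; x2]) x.
  by move=> yA xy; rewrite in_set yA.
have [||||cyc|[_ _ nM]] :=
    @spanning_cycle_clique _ edge (K :\ z) [set x1; x2] (@adj_sym G) (@adj_irr G).
- by move=> x y /setD1P[_ xK] /setD1P[_ yK]; apply: Ke.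
- exact: dKS.
- move=> x; rewrite cards2 x12 => /set2P[]->; apply/card_gt1P.
    exists x2, y1; split; [apply: in_nbrs|apply: in_nbrs|].
    + by rewrite !inE eqxx !orbT.
    + exact: e12.
    + by rewrite in_setU y1K'.
    + exact: e11.
    by apply: contraTneq y1K => <-; apply: zKS.
  exists x1, y2; split; [apply: in_nbrs|apply: in_nbrs|].
  + by rewrite !inE eqxx !orbT.
  + by rewrite adj_sym.
  + by rewrite in_setU y2K'.
  + exact: e22.
  by apply: contraTneq y2K => <-; apply: zKS.
- apply/card_gt1P; exists y1, y2; split=> //; apply/boundaryP; split=> //.
    by exists x1; rewrite // !inE eqxx.
  by exists x2; rewrite // !inE eqxx orbT.
- have := spanning_has_cycle cyc.
  have /eqP-> : #|K :\ z :|: [set x1; x2]| == #|K :\ z| + #|[set x1; x2]|.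
    by rewrite (leq_card_setU _ _).2.
  by rewrite cards2 x12 (cardsD1 z K) zK add1n addn2.
(* The exception would place [x2], a neighbour of [x1], in K. *)
have : x2 \in boundary edge (K :\ z) [set x1; x2].
  by rewrite -(nM x1) !inE ?eqxx ?orbT.
by case/boundaryP=> /setD1P[_ x2K] _; have := zKS _ x2S; rewrite x2K.
Qed.

Lemma has_cycle_more j :
  1 < j < #|S| -> 1 < #|boundary edge K S| -> has_cycle G (#|K| + j).
Proof.
case/andP=> j_gt1 ltjS /card_gt1P[y1 [y2 [/boundaryP[y1K [x1 x1S e11]]]]].
move=> /boundaryP[y2K [x2 x2S e22]] y12.
have [||S' [xS' S'S cS']] := @subset_between _ [set x1; x2] S j.
- by rewrite subUset !sub1set x1S.
- rewrite (ltnW ltjS) andbT cards2; lia.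
have bS' : 1 < #|boundary edge K S'|.
  apply/card_gt1P; exists y1, y2; split=> //; apply/boundaryP; split=> //.
    by exists x1; rewrite // (subsetP xS') // !inE eqxx.
  by exists x2; rewrite // (subsetP xS') // !inE eqxx orbT.
have cyc S'' : S'' \subset S -> #|S''| = j -> spanning_cycle edge (K :|: S'') ->
    has_cycle G (#|K| + j).
  by move=> S''S <- /spanning_has_cycle; rewrite card_clique_setU.
have [/(cyc _ S'S cS')//|[cM MK nM]] := spanning_cycle_subset S'S bS'.
have /properP[_ [z zS zS']] : S' \proper S by rewrite properEcard S'S cS'.
have /card_gt1P[x [x' [xS'1 x'S' xx']]] : 1 < #|S'| by rewrite cS'.
(* In the exceptional case [x'] has only j neighbours in K :|: S', so degree at least |S| forces it
   to see all of S :\: S'. *)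
have ex'z : edge x' z.
  apply: contraLR (degS (subsetP S'S _ x'S')) => nx'z; rewrite -ltnNge.
  have sub : [set y | adj x' y] \subset
      nbrs edge (K :|: S') x' :|: (S :\: S') :\ z.
    apply/subsetP=> y; rewrite !inE => x'y; rewrite x'y.
    have -> : y != z by apply: contraNneq nx'z => <-.
    by case: (y \in K); case: (y \in S').
  have cSz : #|S :\: S'| = #|(S :\: S') :\ z|.+1.
    by rewrite (cardsD1 z) in_setD zS zS'.
  rewrite -(cardsID S' S) (setIidPr S'S) cSz addnS ltnS.
  apply: leq_trans (subset_leq_card sub) _.
  apply: leq_trans (leq_card_setU _ _).1 _.
  by rewrite nM // cM.
(* x' is adjacent to z, so exchanging x for z breaks the exceptional
   structure. *)
set S'' := z |: (S' :\ x).
have S''S : S'' \subset S.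
  by rewrite subUset sub1set zS (subset_trans (subsetDl _ _) S'S).
have cS'' : #|S''| = j.
  by rewrite cardsU1 in_setD1 (negPf zS') andbF -cS' (cardsD1 x S') xS'1.
have x'S'' : x' \in S'' by rewrite !inE (eq_sym x' x) xx' x'S' orbT.
(* The retained vertex [x'] alone already sees the whole old boundary. *)
have bM : boundary edge K S' \subset boundary edge K S''.
  apply/subsetP=> y yM; have : y \in nbrs edge (K :|: S') x' by rewrite nM.
  rewrite inE => /andP[_ x'y]; apply/boundaryP; split; last by exists x'.
  by case/boundaryP: yM.
have [|/(cyc _ S''S cS'')//|[_ _ nM'']] := spanning_cycle_subset S''S.
  exact: leq_trans bS' (subset_leq_card bM).
have : z \in boundary edge K S'' by rewrite -(nM'' x') // !inE ex'z eqxx orbT.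
by case/boundaryP=> zK; rewrite inE zK in zS.
Qed.

(** Subcliques give lengths up to |K| and the two preceding lemmas those strictly between |K| and
    |G|; only the spanning cycle can fail. *)
Lemma pancyclic_or_extremal : 2 < #|K| ->
    (0 < #|S| -> 1 < #|boundary edge K S|) ->
  pancyclic G
  \/ [/\ #|boundary edge K S| = #|S|, boundary edge K S \proper K, 0 < #|S|
       & {in S, forall x y, adj x y = (y \in boundary edge K S)}].
Proof.
move=> K_gt2 M_gt1.
have KS : K :|: S = setT by rewrite setUCr.
have cG : #|G| = #|K| + #|S| by rewrite cardsC.
have small k : 3 <= k <= #|K| -> has_cycle G k.
  case/andP=> k3 kK; have [||A [_ AK cA]] := @subset_between _ set0 K k.
  - exact: sub0set.
  - by rewrite cards0.
  rewrite -cA in k3 *; apply: spanning_has_cycle.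
  apply: clique_spanning_cycle; last exact: ltnW.
  by move=> x y /(subsetP AK) xK /(subsetP AK); apply: Ke.
have [S0|S_gt0] := posnP #|S|.
  by left=> k; rewrite cG S0 addn0; apply: small.
have {}M_gt1 := M_gt1 S_gt0.
have large k : #|K| < k < #|G| -> has_cycle G k.
  move=> /andP[Kk kG]; have [->|k1] := eqVneq k #|K|.+1.
    exact: has_cycle_one_more.
  rewrite -(subnKC (ltnW Kk)); apply: has_cycle_more => //; lia.
have [cyc|[cM MK nM]] := spanning_cycle_subset (subxx S) M_gt1.
  left=> k /andP[k3 kG]; have [kK|Kk] := leqP k #|K|.
    by apply: small; rewrite k3.
  have [kn|kn] := eqVneq k #|G|; last by apply: large; lia.
  by rewrite kn -cardsT -KS; apply: spanning_has_cycle.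
by right; split=> // x xS y; rewrite -(nM x xS) inE KS inE.
Qed.

End Pancyclic.

Lemma triangle_clique x y z :
  edge x y -> edge y z -> edge x z -> 2 < clique_number G.
Proof.
move=> xy yz xz; have neq u v : edge u v -> u != v.
  by apply: contraTneq => ->; rewrite adj_irr.
have c3 : #|[set x; y; z]| = 3.
  by rewrite setUC cardsU1 cards2 !inE neq // negb_or ![z == _]eq_sym !neq.
rewrite -c3; apply: clique_card_le => u v; rewrite !inE.
by move=> /orP[/orP[]|] /eqP-> /orP[/orP[]|] /eqP->;
  rewrite ?eqxx // adj_sym.
Qed.

End Graphs.

(** * Recognition of the exceptional graphs *)

Lemma isomorphic_inj (G H : sgraph) (f : H -> G) :
    injective f -> #|G| = #|H| -> {mono f : u v / adj u v} ->
  isomorphic G H.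
Proof.
move=> f_inj cGH f_mono.
have [|g fK gK] := inj_card_bij f_inj; first by rewrite cGH.
by exists g => [|x y]; [exists f | rewrite -f_mono !gK].
Qed.

Section Enumeration.
Variables (T : finType) (A : {set T}) (n : nat) (En : n = #|A|).

Definition nth_elt (i : 'I_n) : T := enum_val (cast_ord En i).

Lemma nth_eltP i : nth_elt i \in A. Proof. exact: enum_valP. Qed.

Lemma nth_elt_inj : injective nth_elt.
Proof. by move=> i j /enum_val_inj/cast_ord_inj. Qed.

End Enumeration.

Lemma isomorphic_complete_bipartite (G : sgraph) (A : {set G}) a b :
    a = #|A| -> b = #|~: A| ->
    (forall x y : G, adj x y = ((x \in A) != (y \in A))) ->
  isomorphic G (complete_bipartite a b).
Proof.
move=> Ea Eb adjE.
(* Mapping out of the model graph lets adjacency be checked by cases on the sum type. *)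
pose f (u : complete_bipartite a b) : G :=
  match u with inl i => nth_elt Ea i | inr j => nth_elt Eb j end.
have fA u : (f u \in A) = if u is inl _ then true else false.
  case: u => i /=; first exact: nth_eltP.
  by apply: negbTE; rewrite -in_setC nth_eltP.
apply: (@isomorphic_inj _ _ f) => [u v fuv||u v].
- by have := fA u; rewrite fuv fA; case: u v fuv => i [] j //= /nth_elt_inj->.
- transitivity #|{: 'I_a + 'I_b}|; last by [].
  by rewrite card_sum !card_ord Ea Eb cardsC.
by rewrite adjE !fA; case: u; case: v.
Qed.

(** Since M lies in K, the adjacency condition makes the complement of K independent and joined
    exactly to M. *)
Lemma isomorphic_extremal (G : sgraph) (K M : {set G}) a b c :
    M \subset K -> clique_in (@adj G) K ->
    {in ~: K, forall x y, adj x y = (y \in M)} ->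
    a = #|M| -> b = #|K :\: M| -> c = #|~: K| ->
  isomorphic G (join (complete a) (disjoint_union (complete b) (edgeless c))).
Proof.
move=> MK Ke adjS Ea Eb Ec.
pose f (u : join (complete a) (disjoint_union (complete b) (edgeless c))) : G :=
  match u with
  | inl i => nth_elt Ea i
  | inr (inl i) => nth_elt Eb i
  | inr (inr i) => nth_elt Ec i
  end.
have fM u : (f u \in M) = if u is inl _ then true else false.
  case: u => [i|[i|i]] /=; first exact: nth_eltP.
    by have := nth_eltP Eb i; rewrite inE => /andP[/negPf].
  by apply: contraTF (nth_eltP Ec i) => /(subsetP MK) iK; rewrite inE iK.
have fK u : (f u \in K) = if u is inr (inr _) then false else true.
  case: u => [i|[i|i]] /=; first exact: (subsetP MK) (nth_eltP _ _).
    by have := nth_eltP Eb i; rewrite inE => /andP[].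
  by have := nth_eltP Ec i; rewrite inE => /negPf.
have f_inj : injective f.
  move=> u v fuv; have := fM u; have := fK u; rewrite fuv fM fK.
  by case: u v fuv => [i|[i|i]] [j|[j|j]] //= /nth_elt_inj->.
apply: (@isomorphic_inj _ _ f) => // [|u v].
  transitivity #|{: 'I_a + ('I_b + 'I_c)}|; last by [].
  rewrite !card_sum !card_ord Ea Eb Ec addnA -(cardsC K) -(cardsID M K).
  by rewrite (setIidPr MK).
have [uK|uK] := boolP (f u \in K); last first.
  have -> : adj (f u) (f v) = (f v \in M) by apply: adjS; rewrite inE.
  by move: uK; rewrite fK fM; case: u => [i|[i|i]] //; case: v => [j|[j|j]].
have [vK|vK] := boolP (f v \in K); last first.
  have -> : adj (f u) (f v) = (f u \in M).
    by rewrite adj_sym; apply: adjS; rewrite inE.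
  by move: uK vK; rewrite !fK fM; case: u => [i|[i|i]]; case: v => [j|[j|j]].
have -> : adj (f u) (f v) = (f u != f v).
  have [->|neq] := eqVneq; first by rewrite adj_irr.
  exact: Ke.
rewrite (inj_eq f_inj); move: uK vK; rewrite !fK.
by case: u => [i|[i|i]] //; case: v => [j|[j|j]].
Qed.

(** There is no triangle and all degrees are at least n - 2. Ends of an edge have disjoint
    neighbourhoods, so 2(n - 2) <= n; order 3 would give a triangle, hence n = 4. *)
Lemma isomorphic_four_cycle (G : sgraph) :
    clique_number G <= 2 -> k_connected G 2 ->
    #|G| <= min_degree G + clique_number G ->
  isomorphic G (complete_bipartite 2 2).
Proof.
move=> w2 conn sum; have n_gt2 : 2 < #|G| by case: conn.
have no_triangle (x y z : G) : adj x y -> adj y z -> adj x z = false.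
  move=> xy yz; apply: contraTF w2 => xz; rewrite -ltnNge.
  exact: triangle_clique xy yz xz.
have deg (x : G) : #|G| <= degree x + 2.
  by apply: leq_trans sum _; apply: leq_add w2; apply: min_degree_le.
have /card_gt0P[x _] : 0 < #|G| by lia.
have /card_gt0P[y] : 0 < degree x by have := deg x; lia.
rewrite inE => xy.
have x'y : x != y by apply: contraTneq xy => ->; rewrite adj_irr.
have c2 : #|[set x; y]| = 2 by rewrite cards2 x'y.
have cC : #|~: [set x; y]| = #|G| - 2 by rewrite cardsCs setCK c2.
have bd : boundary (@adj G) [set x; y] (~: [set x; y]) = [set x; y].
  apply/eqP; rewrite eqEcard c2 two_connected_boundary ?c2 //.
    by rewrite andbT; apply/subsetP=> z /boundaryP[].
  by rewrite cC; lia.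
(* With three vertices, both [x] and [y] lie in the boundary, so the third vertex is adjacent to
   both. *)
have n_gt3 : 3 < #|G|.
  rewrite ltnNge; apply/negP=> n_le3.
  have /eqP/cards1P[z zE] : #|~: [set x; y]| = 1 by rewrite cC; lia.
  have adjz u : u \in [set x; y] -> adj z u.
    by rewrite -bd zE => /boundaryP[_ [v /set1P->]].
  have /negP[] := negbT (no_triangle z x y (adjz x (set21 _ _)) xy).
  exact: adjz (set22 _ _).
pose N u := [set v : G | adj u v].
have dN : [disjoint N x & N y].
  apply/pred0P=> z; apply/negP=> /= /andP[]; rewrite !inE => xz yz.
  by rewrite (no_triangle _ _ _ xy yz) in xz.
have cN : #|N x| + #|N y| <= #|G|.
  have /eqP <- : #|N x :|: N y| == #|N x| + #|N y|.
    by rewrite (leq_card_setU _ _).2.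
  exact: max_card.
have cN2 u : 2 <= #|N u| by have := deg u; rewrite /degree -/(N u); lia.
have [cx cy c4] : [/\ #|N x| = 2, #|N y| = 2 & #|G| = 4].
  have := deg x; have := deg y; rewrite /degree -/(N x) -/(N y).
  by have := cN2 x; have := cN2 y; split; lia.
have Ny : N y = ~: N x.
  apply/eqP; rewrite eqEcard cardsCs setCK cx cy c4 andbT.
  by rewrite -disjoints_subset disjoint_sym.
apply: (@isomorphic_complete_bipartite _ (N x)); rewrite -?Ny ?cx ?cy //.
have indep w u v : u \in N w -> v \in N w -> adj u v = false.
  rewrite !inE => wu wv; apply: contraTF wv => uv.
  by rewrite (no_triangle _ _ _ wu uv).
have full u v : u \in N y -> v \in N x -> adj u v.
  move=> uy; suff <- : N u = N x by rewrite inE.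
  apply/eqP; rewrite eqEcard cx cN2 andbT; apply/subsetP=> z uz.
  rewrite -[N x]setCK -Ny inE; apply: contraL uz => zy.
  by rewrite inE (indep y).
move=> u v; have [ux|ux] := boolP (u \in N x); have [vx|vx] := boolP (v \in N x).
- exact: indep ux vx.
- by rewrite adj_sym full // Ny inE.
- by rewrite full // Ny inE.
- by apply: (indep y); rewrite Ny inE.
Qed.

(* MathComp world. The two natural subtractions in the last graph do not
   truncate: the stated bounds give omega <= n <= 2 * omega. *)
Theorem theorem1p4 (G : sgraph) (n delta omega : nat)
    (Hn : #|G| = n)
    (Hdelta : min_degree G = delta)
    (Homega : clique_number G = omega)
    (H2conn : k_connected G 2)
    (Hsum : n <= delta + omega) :
  pancyclic G
  \/ isomorphic G (complete_bipartite 2 2)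
  \/ (n + 1 <= 2 * omega /\ omega + 2 <= n
      /\ isomorphic G
           (join (complete (n - omega))
                 (disjoint_union (complete (2 * omega - n))
                                 (edgeless (n - omega))))).
Proof.
subst n delta omega; have [w2|w_gt2] := leqP (clique_number G) 2.
  by right; left; apply: isomorphic_four_cycle.
have [K Ke cK] := max_clique_exists G; rewrite -cK in w_gt2 Hsum *.
have cG : #|G| = #|K| + #|~: K| by rewrite cardsC.
have degS : {in ~: K, forall x, #|~: K| <= degree x}.
  move=> x _; apply: leq_trans (min_degree_le x); lia.
have bd : 0 < #|~: K| -> 1 < #|boundary (@adj G) K (~: K)|.
  by move=> S_gt0; apply: two_connected_boundary => //; apply: ltnW.
have [|[cM MK S_gt0 adjS]] := pancyclic_or_extremal Ke degS w_gt2 bd.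
  by left.
have ltMK := proper_card MK; have {}bd := bd S_gt0.
(* With |M| = |S| = n - omega, the first bound is |M| < |K| and the second is |M| > 1. *)
right; right; split; [lia|split; [lia|]].
apply: (isomorphic_extremal (proper_sub MK) Ke adjS); rewrite ?cM; try lia.
by rewrite cardsD (setIidPr (proper_sub MK)) cM; lia.
Qed.
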